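(* Let $\alpha = \{\alpha_g : \mathcal{D}_{g^{-1}} \to \mathcal{D}_g \ (g\in G)\}$ be a partial action of a group $G$ on an algebra $\mathcal{A}$ such that each $\mathcal{D}_g$ $(g\in G)$ is either idempotent or non-degenerate. Then the skew group ring $\mathcal{A}\rtimes_\alpha G$ is associative.
   Context: Let $K$ be a field. An algebra means an associative $K$-algebra, not necessarily unital; ideals are two-sided. A partial action $\alpha$ of a group $G$ (with identity $1$) on an algebra $\mathcal{A}$ is a collection of ideals $\mathcal{D}_g$ of $\mathcal{A}$ $(g\in G)$ and algebra isomorphisms $\alpha_g:\mathcal{D}_{g^{-1}}\to\mathcal{D}_g$ such that: (i) $\mathcal{D}_1=\mathcal{A}$ and $\alpha_1$ is the identity map of $\mathcal{A}$; (ii) $\mathcal{D}_{(gh)^{-1}}\supseteq \alpha_h^{-1}(\mathcal{D}_h\cap\mathcal{D}_{g^{-1}})$ for all $g,h\in G$; (iii) $\alpha_g\circ\alpha_h(x)=\alpha_{gh}(x)$ for each $x\in\alpha_h^{-1}(\mathcal{D}_h\cap\mathcal{D}_{g^{-1}})$. The skew group ring $\mathcal{A}\rtimes_\alpha G$ is the set of all finite formal sums $\sum_{g\in G}a_g\delta_g$ with $a_g\in\mathcal{D}_g$, where the $\delta_g$ are symbols, with the obvious addition and with (bilinear) multiplication determined by $(a_g\delta_g)\cdot(b_h\delta_h)=\alpha_g(\alpha_{g^{-1}}(a_g)b_h)\delta_{gh}$. It is a priori a not necessarily associative algebra. An ideal (or algebra) $\mathcal{I}$ is idempotent if $\mathcal{I}^2=\mathcal{I}$,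 where $\mathcal{I}^2$ is the linear span of all products $ab$, $a,b\in\mathcal{I}$. It is non-degenerate if for every non-zero $a\in\mathcal{I}$ there exists $b\in\mathcal{I}$ such that $ab\neq0$ or $ba\neq0$. *)

(* Defs.v *)
From HB Require Import structures.
From mathcomp Require Import all_boot all_algebra.
From mathcomp Require Import boolp classical_sets functions.
From mathcomp Require Import finmap monalg.

Set Implicit Arguments.
Unset Strict Implicit.
Unset Printing Implicit Defensive.

Import GRing.Theory.
Local Open Scope ring_scope.
Local Open Scope classical_set_scope.

(* The algebras of the MathComp hierarchy are unital and associative, hence the
   two structures below. *)
HB.mixin Record Lmodule_isNonAssocAlg (K : fieldType) A
    of GRing.Lmodule K A := {
  amul : A -> A -> A;
  amulDl : left_distributive amul +%R;
  amulDr : right_distributive amul +%R;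
  amulZl : forall (c : K) (x y : A), amul (c *: x) y = c *: amul x y;
  amulZr : forall (c : K) (x y : A), amul x (c *: y) = c *: amul x y
}.

#[short(type="nonAssocAlgType")]
HB.structure Definition NonAssocAlg (K : fieldType) :=
  {A of Lmodule_isNonAssocAlg K A & GRing.Lmodule K A}.

HB.mixin Record NonAssocAlg_isAssoc (K : fieldType) A of NonAssocAlg K A := {
  amulA : associative (@amul K A)
}.

#[short(type="assocAlgType")]
HB.structure Definition AssocAlg (K : fieldType) :=
  {A of NonAssocAlg_isAssoc K A & NonAssocAlg K A}.

Notation "x ** y" := (amul x y) (at level 40, left associativity) : ring_scope.

Section Ideals.
Variables (K : fieldType) (A : nonAssocAlgType K).
Implicit Types (I J : set A) (f : A -> A).

Definition is_ideal I : Prop :=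
  [/\ I 0,
      forall (c : K) x y, I x -> I y -> I (c *: x + y),
      forall a x, I x -> I (a ** x)
    & forall a x, I x -> I (x ** a)].

Definition linear_span (X : set A) : set A :=
  [set \sum_(p <- s) p.1 *: p.2
  | s in [set s : seq (K * A) | forall p, p \in s -> X p.2]].

Definition ideal_square I : set A :=
  linear_span [set a ** b | a in I & b in I].

Definition idempotent_ideal I : Prop := ideal_square I = I.

Definition nondegenerate_ideal I : Prop :=
  forall a, I a -> a <> 0 -> exists2 b, I b & a ** b <> 0 \/ b ** a <> 0.

(* A map I -> J is represented by a total map on A, of which only the values on
   I are relevant. *)
Definition alg_iso I J f : Prop :=
  [/\ set_bij I J f,
      forall (c : K) x y, I x -> I y -> f (c *: x + y) = c *: f x + f y
    & forall x y, I x -> I y -> f (x ** y) = f x ** f y].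

End Ideals.

(* [pdom alpha g] is D_g and [pact alpha g] is alpha_g : D_{g^-1} -> D_g; the
   set alpha_h^-1(D_h `&` D_{g^-1}) is the preimage under alpha_h, taken inside
   its domain D_{h^-1}. *)
Record partial_action (K : fieldType) (G : groupType) (A : assocAlgType K) :=
  PartialAction {
  pdom : G -> set A;
  pact : G -> A -> A;
  pdom_ideal : forall g, is_ideal (pdom g);
  pact_iso : forall g, alg_iso (pdom g^-1%g) (pdom g) (pact g);
  pdom1 : pdom 1%g = setT;
  pact1 : forall x, pact 1%g x = x;
  pdomM : forall g h,
    pdom h^-1%g `&` pact h @^-1` (pdom h `&` pdom g^-1%g)
      `<=` pdom ((g * h)^-1)%g;
  pactM : forall g h x,
    (pdom h^-1%g `&` pact h @^-1` (pdom h `&` pdom g^-1%g)) x ->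
    pact g (pact h x) = pact (g * h)%g x
}.

Section SkewGroupRing.
Variables (K : fieldType) (G : groupType) (A : assocAlgType K).
Variable alpha : partial_action G A.
Local Notation D := (pdom alpha).
Local Notation act := (pact alpha).

Definition skew_pred : pred {malg A[G]} := fun x => `[< forall g, D g x@_g >].

Record skew_group_ring := SkewGroupRing {
  skew_val :> {malg A[G]};
  skew_valP : skew_pred skew_val
}.

HB.instance Definition _ := [isSub for skew_val].
HB.instance Definition _ := [Choice of skew_group_ring by <:].

Lemma pdom0 g : D g 0.
Proof. by case: (pdom_ideal alpha g). Qed.

Lemma pdomP g (c : K) x y : D g x -> D g y -> D g (c *: x + y).
Proof. by case: (pdom_ideal alpha g) => _ + _ _; exact. Qed.

Lemma pdomD g x y : D g x -> D g y -> D g (x + y).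
Proof. by move=> Dx Dy; rewrite -[x]scale1r; exact: pdomP. Qed.

Lemma pdomZ g (c : K) x : D g x -> D g (c *: x).
Proof. by move=> Dx; rewrite -[_ *: _]addr0; apply: pdomP Dx (pdom0 g). Qed.

Fact skew_zmod_closed : zmod_closed skew_pred.
Proof.
split=> [|x y /asboolP Dx /asboolP Dy]; apply/asboolP => g.
  by rewrite mcoeff0; exact: pdom0.
by rewrite mcoeffB -scaleN1r addrC; exact: pdomP.
Qed.

HB.instance Definition _ :=
  GRing.isZmodClosed.Build {malg A[G]} skew_pred skew_zmod_closed.
HB.instance Definition _ := [SubChoice_isSubZmodule of skew_group_ring by <:].

Definition malg_scale (c : K) (x : {malg A[G]}) : {malg A[G]} :=
  [malg g in msupp x => c *: x@_g].

Lemma malg_scaleE c x g : (malg_scale c x)@_g = c *: x@_g.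
Proof. by rewrite mcoeffE; case: msuppP => //; rewrite scaler0. Qed.

Fact skew_scale_subproof c (x : skew_group_ring) :
  skew_pred (malg_scale c (val x)).
Proof.
apply/asboolP => g; rewrite malg_scaleE.
by apply: pdomZ; move/asboolP: (valP x); exact.
Qed.

Definition skew_scale c x : skew_group_ring :=
  SkewGroupRing (skew_scale_subproof c x).

Lemma skewP (x y : skew_group_ring) :
  (forall g, (val x)@_g = (val y)@_g) <-> x = y.
Proof. by split=> [e|->//]; apply/val_inj/malgP. Qed.

Lemma skew_valD (x y : skew_group_ring) : val (x + y) = val x + val y.
Proof. exact: raddfD. Qed.

Lemma skew_coeffD (x y : skew_group_ring) g : (x + y)@_g = x@_g + y@_g.
Proof. by rewrite -mcoeffD -skew_valD. Qed.

Lemma skew_val_in (x : skew_group_ring) g : D g (val x)@_g.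
Proof. by move/asboolP: (valP x); exact. Qed.

Fact skew_scaleA c d x : skew_scale c (skew_scale d x) = skew_scale (c * d) x.
Proof. by apply/skewP => g; rewrite !malg_scaleE scalerA. Qed.

Fact skew_scale1 : left_id 1 skew_scale.
Proof. by move=> x; apply/skewP => g; rewrite malg_scaleE scale1r. Qed.

Fact skew_scaleDr : right_distributive skew_scale +%R.
Proof.
move=> c x y; apply/skewP => g.
by rewrite skew_valD mcoeffD !malg_scaleE skew_valD mcoeffD scalerDr.
Qed.

Fact skew_scaleDl x : {morph skew_scale^~ x : c d / c + d}.
Proof.
move=> c d; apply/skewP => g.
by rewrite skew_valD mcoeffD !malg_scaleE scalerDl.
Qed.

HB.instance Definition _ := GRing.Zmodule_isLmodule.Build K skew_group_ring
  skew_scaleA skew_scale1 skew_scaleDr skew_scaleDl.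

(* The coefficient of delta_{gh} in (a delta_g) (b delta_h). *)
Definition skew_coef g (a b : A) : A := act g (act g^-1%g a ** b).

(* The term [<< a *g g >>] of {malg A[G]} is a delta_g. *)
Definition malg_skew_mul (x y : {malg A[G]}) : {malg A[G]} :=
  \sum_(g <- msupp x) \sum_(h <- msupp y)
    << skew_coef g x@_g y@_h *g (g * h)%g >>.

Lemma pactK g x : D g x -> act g (act g^-1%g x) = x.
Proof.
move=> Dx; rewrite (@pactM _ _ _ alpha) ?mulgV ?pact1 //.
have [[/(_ x) + _ _] _ _] := pact_iso alpha g^-1%g.
by rewrite invgK => /(_ Dx) D'; split.
Qed.

Lemma pact_dom g x : D g^-1%g x -> D g (act g x).
Proof. by case: (pact_iso alpha g) => -[+ _ _] _ _; exact. Qed.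

Lemma pactV_dom g x : D g x -> D g^-1%g (act g^-1%g x).
Proof. by move=> Dx; apply: pact_dom; rewrite invgK. Qed.

Lemma pactVK g x : D g^-1%g x -> act g^-1%g (act g x) = x.
Proof. by move=> /pactK; rewrite invgK. Qed.

Lemma pactP g (c : K) x y : D g^-1%g x -> D g^-1%g y ->
  act g (c *: x + y) = c *: act g x + act g y.
Proof. by case: (pact_iso alpha g) => _ + _; exact. Qed.

Lemma pactD g x y : D g^-1%g x -> D g^-1%g y -> act g (x + y) = act g x + act g y.
Proof. by move=> Dx Dy; rewrite -[x]scale1r pactP // !scale1r. Qed.

Lemma pact0 g : act g 0 = 0.
Proof.
have D0 := pdom0 g^-1%g; have := pactD D0 D0.
by rewrite addr0 -[LHS]addr0 => /addrI.
Qed.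

Lemma pactZ g (c : K) x : D g^-1%g x -> act g (c *: x) = c *: act g x.
Proof.
by move=> Dx; rewrite -[_ *: x]addr0 (pactP _ Dx (pdom0 _)) pact0 addr0.
Qed.

Lemma pdom_mull g a x : D g x -> D g (a ** x).
Proof. by case: (pdom_ideal alpha g) => _ _ + _; exact. Qed.

Lemma pdom_mulr g a x : D g x -> D g (x ** a).
Proof. by case: (pdom_ideal alpha g) => _ _ _; exact. Qed.

Lemma pact_domM g h x : D g^-1%g x -> D h x -> D (g * h)%g (act g x).
Proof.
move=> Dgx Dhx.
have := @pdomM _ _ _ alpha h^-1%g g^-1%g (act g x).
rewrite !invgK invgM !invgK; apply; split; first exact: pact_dom.
by rewrite /preimage /= pactVK.
Qed.

Lemma skew_coef_dom g h a b : D g a -> D h b -> D (g * h)%g (skew_coef g a b).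
Proof.
move=> Da Db; apply: pact_domM; last exact: pdom_mull.
by apply: pdom_mulr; exact: pactV_dom.
Qed.

Lemma skew_predU g a : D g a -> skew_pred << a *g g >>.
Proof.
move=> Da; apply/asboolP => h; rewrite mcoeffU.
by case: eqVneq => [<-|_]; rewrite ?mulr1n // mulr0n; exact: pdom0.
Qed.

Fact skew_mul_subproof (x y : skew_group_ring) :
  skew_pred (malg_skew_mul (val x) (val y)).
Proof.
rewrite -[skew_pred _]/(_ \in skew_pred).
apply: rpred_sum => g _; apply: rpred_sum => h _.
by apply: skew_predU; apply: skew_coef_dom; exact: skew_val_in.
Qed.

Definition skew_mul x y : skew_group_ring :=
  SkewGroupRing (skew_mul_subproof x y).

Lemma amul0r (x : A) : (0 : A) ** x = 0.
Proof. by have := amulZl 0 0 x; rewrite !scale0r. Qed.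

Lemma amulr0 (x : A) : x ** (0 : A) = 0.
Proof. by have := amulZr 0 x 0; rewrite !scale0r. Qed.

Lemma skew_coef0r g a : skew_coef g a 0 = 0.
Proof. by rewrite /skew_coef amulr0 pact0. Qed.

Lemma skew_coef0l g b : skew_coef g 0 b = 0.
Proof. by rewrite /skew_coef pact0 amul0r pact0. Qed.

Local Open Scope fset_scope.

Lemma malg_skew_mulEw (x y : {malg A[G]}) (d e : {fset G}) :
  msupp x `<=` d -> msupp y `<=` e ->
  malg_skew_mul x y = \sum_(g <- d) \sum_(h <- e)
    << skew_coef g x@_g y@_h *g (g * h)%g >>.
Proof.
move=> xd ye; rewrite /malg_skew_mul.
rewrite (big_fset_incl _ xd) => [|g _ gNx]; last first.
  rewrite big1 // => h _.
  by rewrite (mcoeff_outdom gNx) skew_coef0l monalgU0.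
apply: eq_bigr => g _; rewrite (big_fset_incl _ ye) => // h _ hNy.
by rewrite (mcoeff_outdom hNy) skew_coef0r monalgU0.
Qed.

(* (a delta_g) (b delta_h) = alpha_g (alpha_{g^-1}(a) b) delta_{gh} *)
Lemma malg_skew_mulU g h a b :
  malg_skew_mul << a *g g >> << b *g h >> = << skew_coef g a b *g (g * h)%g >>.
Proof.
rewrite (malg_skew_mulEw (d := [fset g]) (e := [fset h])) ?msuppU_le //.
by rewrite !big_seq_fset1 !mcoeffUU.
Qed.

Fact skew_mulDl : left_distributive skew_mul +%R.
Proof.
move=> x y z; apply: val_inj; rewrite skew_valD /=.
have Ux : msupp (val x) `<=` msupp (val x) `|` msupp (val y).
  exact: fsubsetUl.
have Uy : msupp (val y) `<=` msupp (val x) `|` msupp (val y).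
  exact: fsubsetUr.
have Uxy : msupp (val (x + y)%R) `<=` msupp (val x) `|` msupp (val y).
  by rewrite skew_valD; exact: msuppD_le.
rewrite (malg_skew_mulEw Ux (fsubset_refl _)).
rewrite (malg_skew_mulEw Uy (fsubset_refl _)).
rewrite (malg_skew_mulEw Uxy (fsubset_refl _)).
rewrite -big_split; apply: eq_bigr => g _ /=.
rewrite -big_split; apply: eq_bigr => h _ /=.
rewrite -raddfD; congr (<< _ *g _ >>); rewrite skew_coeffD /skew_coef.
rewrite pactD ?amulDl ?pactD ?invgK //; try exact: skew_val_in.
  by apply/pdom_mulr/pactV_dom/skew_val_in.
by apply/pdom_mulr/pactV_dom/skew_val_in.
Qed.

Fact skew_mulDr : right_distributive skew_mul +%R.
Proof.
move=> z x y; apply: val_inj; rewrite skew_valD /=.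
have Ux : msupp (val x) `<=` msupp (val x) `|` msupp (val y).
  exact: fsubsetUl.
have Uy : msupp (val y) `<=` msupp (val x) `|` msupp (val y).
  exact: fsubsetUr.
have Uxy : msupp (val (x + y)%R) `<=` msupp (val x) `|` msupp (val y).
  by rewrite skew_valD; exact: msuppD_le.
rewrite (malg_skew_mulEw (fsubset_refl _) Ux).
rewrite (malg_skew_mulEw (fsubset_refl _) Uy).
rewrite (malg_skew_mulEw (fsubset_refl _) Uxy).
rewrite -big_split; apply: eq_bigr => g _ /=.
rewrite -big_split; apply: eq_bigr => h _ /=.
rewrite -raddfD; congr (<< _ *g _ >>); rewrite skew_coeffD /skew_coef.
by rewrite amulDr pactD //; apply/pdom_mulr/pactV_dom/skew_val_in.
Qed.

Lemma msupp_malg_scale c x : msupp (malg_scale c x) `<=` msupp x.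
Proof.
apply/fsubsetP => g; rewrite -!mcoeff_neq0 malg_scaleE.
by apply: contra_neq => ->; rewrite scaler0.
Qed.

Lemma malg_scaleU c g a : malg_scale c << a *g g >> = << c *: a *g g >>.
Proof.
apply/malgP => h; rewrite malg_scaleE !mcoeffU.
by case: eqVneq; rewrite ?mulr1n // !mulr0n scaler0.
Qed.

Lemma malg_scale_sum c (s : seq G) (F : G -> {malg A[G]}) :
  malg_scale c (\sum_(g <- s) F g) = \sum_(g <- s) malg_scale c (F g).
Proof.
apply/malgP => h; rewrite malg_scaleE !raddf_sum /=.
by apply: eq_bigr => g _; rewrite malg_scaleE.
Qed.

Fact skew_mulZl c x y : skew_mul (skew_scale c x) y = skew_scale c (skew_mul x y).
Proof.
apply: val_inj => /=.
rewrite (malg_skew_mulEw (msupp_malg_scale _ _) (fsubset_refl _)).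
rewrite malg_scale_sum; apply: eq_bigr => g _.
rewrite malg_scale_sum; apply: eq_bigr => h _.
rewrite malg_scaleU malg_scaleE; congr (<< _ *g _ >>); rewrite /skew_coef.
rewrite pactZ ?invgK; last exact: skew_val_in.
by rewrite amulZl pactZ //; apply/pdom_mulr/pactV_dom/skew_val_in.
Qed.

Fact skew_mulZr c x y : skew_mul x (skew_scale c y) = skew_scale c (skew_mul x y).
Proof.
apply: val_inj => /=.
rewrite (malg_skew_mulEw (fsubset_refl _) (msupp_malg_scale _ _)).
rewrite malg_scale_sum; apply: eq_bigr => g _.
rewrite malg_scale_sum; apply: eq_bigr => h _.
rewrite malg_scaleU malg_scaleE; congr (<< _ *g _ >>); rewrite /skew_coef.
by rewrite amulZr pactZ //; apply/pdom_mulr/pactV_dom/skew_val_in.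
Qed.

HB.instance Definition _ := Lmodule_isNonAssocAlg.Build K skew_group_ring
  skew_mulDl skew_mulDr skew_mulZl skew_mulZr.

End SkewGroupRing.

(* Main.v *)
Require Import Defs.
From HB Require Import structures.
From mathcomp Require Import all_boot all_algebra.
From mathcomp Require Import boolp classical_sets functions.
From mathcomp Require Import finmap monalg.

(* Fix c in A.  The map R(b) = alpha_h(alpha_{h^-1}(b) c) on D_h is left
   D_h-linear, and on monomials associativity says exactly that R commutes with
   the left multiplication by any a in A: R(ab) = a R(b).  If D_h is
   idempotent, take b = de and get R(ade) = (ad) R(e) = a R(de).  If D_h is
   non-degenerate, multiply R(ab) - a R(b) by an element d of D_h: on the left
   linearity of R gives 0, and on the right so does R(x) d = x L(d), where
   L(d) = alpha_h(c alpha_{h^-1}(d)). *)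

Set Implicit Arguments.
Unset Strict Implicit.
Unset Printing Implicit Defensive.

Import GRing.Theory.
Local Open Scope ring_scope.
Local Open Scope classical_set_scope.

Section SkewGroupRingAssociativity.
Variables (K : fieldType) (G : groupType) (A : assocAlgType K).
Variable alpha : partial_action G A.
Local Notation D := (pdom alpha).
Local Notation act := (pact alpha).
Local Notation coef := (skew_coef alpha).

Lemma pact_mul g x y : D g^-1%g x -> D g^-1%g y ->
  act g (x ** y) = act g x ** act g y.
Proof. by case: (pact_iso alpha g) => _ _; exact. Qed.

Lemma pact_comp g h x : D h^-1%g x -> D g^-1%g (act h x) ->
  act g (act h x) = act (g * h)%g x.
Proof. by move=> Dx Dhx; apply: pactM; split=> //; split=> //; exact: pact_dom. Qed.

Lemma skew_coef_in h b c : D h b -> D h (coef h b c).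
Proof. by move=> Db; apply/pact_dom/pdom_mulr/pactV_dom. Qed.

Lemma skew_coefP h (k : K) x y c : D h x -> D h y ->
  coef h (k *: x + y) c = k *: coef h x c + coef h y c.
Proof.
move=> Dx Dy; rewrite /skew_coef pactP ?invgK // amulDl amulZl.
by rewrite pactP //; apply/pdom_mulr/pactV_dom.
Qed.

(** The maps alpha_h and alpha_{h^-1} are multiplicative only on their domains, whence the condition
    on [d]. The two commutation lemmas below replace [d] by an arbitrary element of [A]. *)
Lemma skew_coef_mull h d b c : D h d -> D h b ->
  coef h (d ** b) c = d ** coef h b c.
Proof.
move=> Dd Db; have Dd' := pactV_dom Dd; have Db' := pactV_dom Db.
rewrite /skew_coef (pact_mul (g := h^-1%g)) ?invgK // -amulA.
by rewrite [LHS]pact_mul ?pactK //; exact: pdom_mulr.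
Qed.

Lemma skew_coef_mulr h b c d : D h b -> D h d ->
  coef h b c ** d = b ** act h (c ** act h^-1%g d).
Proof.
move=> Db Dd; rewrite /skew_coef.
have Db' := pactV_dom Db; have Dd' := pactV_dom Dd.
rewrite -{1}(pactK Dd) -pact_mul //; last exact: pdom_mulr.
by rewrite -amulA [LHS]pact_mul ?pactK //; exact: pdom_mull.
Qed.

Lemma skew_coef_commute_idempotent h a b c : idempotent_ideal (D h) ->
  D h b -> coef h (a ** b) c = a ** coef h b c.
Proof.
move=> idemD; rewrite -{1}idemD => -[s + <-].
(* Membership of the partial sum in [D h] is carried through the induction, because [skew_coefP]
   needs both terms in [D h]. *)
suff IH : (forall p, p \in s -> [set x ** y | x in D h & y in D h] p.2) ->
    D h (\sum_(p <- s) p.1 *: p.2) /\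
    coef h (a ** \sum_(p <- s) p.1 *: p.2) c
      = a ** coef h (\sum_(p <- s) p.1 *: p.2) c by case/IH.
elim: s => [|[k x] s IHs] Ds.
  by rewrite big_nil amulr0 skew_coef0l amulr0; split=> //; exact: pdom0.
have [|Dsum IH] := IHs; first by move=> p ps; apply: Ds; rewrite inE ps orbT.
have [d Dd [e De /= dex]] := Ds (k, x) (mem_head _ _).
have Dx : D h x by rewrite -dex; exact: pdom_mulr.
rewrite big_cons /=; split; first exact: pdomP.
have Dax := pdom_mull a Dx; have Das := pdom_mull a Dsum.
rewrite amulDr amulZr !skew_coefP //.
rewrite IH amulDr amulZr; congr (_ *: _ + _).
by rewrite -dex amulA !skew_coef_mull ?amulA //; exact: pdom_mull.
Qed.

Lemma skew_coef_commute_nondegenerate h a b c : nondegenerate_ideal (D h) ->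
  D h b -> coef h (a ** b) c = a ** coef h b c.
Proof.
move=> ndegD Db; have Dab := pdom_mull a Db.
have Dl : D h (coef h (a ** b) c) by exact: skew_coef_in.
have Dr : D h (a ** coef h b c) by apply/pdom_mull/skew_coef_in.
apply: contrapT => neq.
(* The difference R(ab) - a R(b), put in the shape of [pdomP]. *)
have [||d Dd] := ndegD (-1 *: (a ** coef h b c) + coef h (a ** b) c).
- exact: pdomP.
- by rewrite scaleN1r addrC => /subr0_eq.
rewrite amulDl amulDr amulZl amulZr !scaleN1r.
case; apply; apply/eqP; rewrite addrC subr_eq0; apply/eqP.
  by rewrite -amulA !skew_coef_mulr // amulA.
by rewrite amulA -!skew_coef_mull ?amulA //; exact: pdom_mulr.
Qed.

(** With a' = alpha_{g^-1}(a), the right side is alpha_g(a' R(b)) and the left side collapses to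
    alpha_g(R(a'b)), so it suffices that R commutes with a'. *)
Lemma skew_coefA g h a b c : D g a -> D h b ->
  idempotent_ideal (D h) \/ nondegenerate_ideal (D h) ->
  coef (g * h)%g (coef g a b) c = coef g a (coef h b c).
Proof.
move=> Da Db DhP; have Da' := pactV_dom Da.
have comm : coef h (act g^-1%g a ** b) c = act g^-1%g a ** coef h b c.
  case: DhP => DhP.
    exact: skew_coef_commute_idempotent.
  exact: skew_coef_commute_nondegenerate.
rewrite [RHS]/skew_coef -comm /skew_coef.
have Dgab : D g^-1%g (act g^-1%g a ** b) by exact: pdom_mulr.
have Dhab : D h (act g^-1%g a ** b) by exact: pdom_mull.
(* The composition law applies because a'b lies in both D_{g^-1} and D_h. *)
have -> : act (g * h)^-1%g (act g (act g^-1%g a ** b))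
          = act h^-1%g (act g^-1%g a ** b).
  rewrite pact_comp //; first by rewrite invgM -mulgA mulVg mulg1.
  by rewrite invgK; exact: pact_domM.
rewrite pact_comp //; first by apply/pdom_mulr/pactV_dom.
(* That R(a'b) lies in D_{g^-1} becomes visible once it is rewritten as a' R(b). *)
by rewrite -/(coef h _ c) comm; exact: pdom_mulr.
Qed.

Definition skew_mono g a (Da : D g a) : skew_group_ring alpha :=
  SkewGroupRing (skew_predU Da).

Lemma skew_monoM g h a b (Da : D g a) (Db : D h b) :
  skew_mono Da ** skew_mono Db = skew_mono (skew_coef_dom Da Db).
Proof. by apply: val_inj; exact: malg_skew_mulU. Qed.

Lemma skew_monoE (x : skew_group_ring alpha) :
  x = \sum_(g <- msupp (val x)) skew_mono (skew_val_in x g).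
Proof. by apply: val_inj; rewrite raddf_sum /= {1}[skew_val x]monalgE. Qed.

Lemma skew_ind (P : skew_group_ring alpha -> Prop) :
  (forall g a (Da : D g a), P (skew_mono Da)) ->
  (forall x y, P x -> P y -> P (x + y)) -> forall x, P x.
Proof.
move=> Pmono PD x; rewrite (skew_monoE x); apply: big_ind => //.
(* The empty sum is itself the monomial 0 delta_1. *)
suff <- : skew_mono (pdom0 alpha 1%g) = 0 by exact: Pmono.
by apply: val_inj; exact: monalgU0.
Qed.

End SkewGroupRingAssociativity.

Theorem corollary3p2 (K : fieldType) (A : assocAlgType K) (G : groupType)
    (alpha : partial_action G A)
    (hD : forall g : G,
       idempotent_ideal (pdom alpha g) \/ nondegenerate_ideal (pdom alpha g)) :
  associative (amul : skew_group_ring alpha -> skew_group_ring alpha ->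
                      skew_group_ring alpha).
Proof.
(* Both sides are additive in each argument, which reduces the claim to monomials. *)
move=> x y z; elim/skew_ind: x => [g a Da|x x' IHx IHx']; last first.
  by rewrite !amulDl IHx IHx'.
elim/skew_ind: y => [h b Db|y y' IHy IHy']; last first.
  by rewrite !(amulDl, amulDr) IHy IHy'.
elim/skew_ind: z => [k c Dc|z z' IHz IHz']; last by rewrite !amulDr IHz IHz'.
(* Degrees agree by associativity in [G], coefficients by [skew_coefA] with [hD] at the middle
   degree [h]. *)
rewrite !skew_monoM; apply: val_inj => /=.
by rewrite -mulgA skew_coefA.
Qed.
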